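(* For every countable ordinal $\lambda>0$, there exists a constructible graph with construction time $\lambda$.
   Context: Graphs are undirected, loopless and connected. A vertex $u$ dominates a vertex $v\neq u$ in a graph if the set consisting of $v$ and all neighbours of $v$ is contained in the set consisting of $u$ and all neighbours of $u$. A (finite or infinite) graph $G$ is constructible if there is an ordinal $\beta$ such that its vertices can be listed (without repetition) as $(x_\alpha)_{\alpha<\beta}$ so that for every $0<\alpha<\beta$ the vertex $x_\alpha$ is dominated in the induced graph $G[\{x_\gamma:\gamma\le\alpha\}]$ by some $x_\gamma$ with $\gamma<\alpha$; such a well-ordering of the vertices is called a construction order, of order-type $\beta$. The construction time (or rank) of a constructible graph $G$ is the least ordinal $\beta$ for which $G$ has a construction order of order-type $\beta$. *)

(* Defs.v *)
From Stdlib Require Import Relation_Operators.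
From mathcomp Require Import ssreflect ssrfun ssrbool.
From mathcomp Require Import boolp classical_sets cardinality wochoice.

Set Implicit Arguments.
Unset Strict Implicit.
Unset Printing Implicit Defensive.

Local Open Scope classical_set_scope.

(* An ordinal is represented by a well-ordered type, considered up to order
   isomorphism: its elements play the role of the ordinals below it. *)
Record ordinal_number := OrdinalNumber {
  below :> Type;
  ole : rel below;
  ole_well_order : well_order ole
}.

Arguments ole {o} : rename.

Definition olt (o : ordinal_number) (a b : o) : bool := ole a b && ~~ ole b a.

(* [o1 <= o2] for ordinals: [o1] is isomorphic to an initial segment of [o2].
   Since [ole] is reflexive and antisymmetric, the [mono] condition makes [f]
   injective. *)
Definition ordinal_leq (o1 o2 : ordinal_number) : Prop :=
  exists f : o1 -> o2,
    {mono f : a b / ole a b >-> ole a b} /\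
    forall a b, ole b (f a) -> exists c, f c = b.

Record graph := Graph {
  vertex :> Type;
  adj : vertex -> vertex -> Prop;
  adj_sym : forall u v, adj u v -> adj v u;
  adj_irrefl : forall u, ~ adj u u;
  adj_connected : forall u v, clos_refl_trans vertex adj u v
}.

Arguments adj {g} : rename.

Definition closed_nbhd_in (G : graph) (A : set G) (v : G) : set G :=
  [set w | A w /\ (w = v \/ adj v w)].

(* Domination of [v] by [u] in the induced subgraph [G[A]]. *)
Definition dominates_in (G : graph) (A : set G) (u v : G) : Prop :=
  [/\ A u, A v, u <> v & closed_nbhd_in A v `<=` closed_nbhd_in A u].

(* The premise [exists c, olt c a] says that [a] is not the index 0. *)
Definition construction_order (G : graph) (o : ordinal_number) (x : o -> G) :
    Prop :=
  bijective x /\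
  forall a : o, (exists c, olt c a) ->
    exists2 c, olt c a & dominates_in (x @` [set d | ole d a]) (x c) (x a).

Definition has_construction_order (G : graph) (o : ordinal_number) : Prop :=
  exists x : o -> G, construction_order x.

Definition constructible (G : graph) : Prop :=
  exists o : ordinal_number, has_construction_order G o.

(* The construction time is the least order-type of a construction order; it is
   a relation because ordinals are only determined up to isomorphism. *)
Definition is_construction_time (G : graph) (o : ordinal_number) : Prop :=
  has_construction_order G o /\
  forall o' : ordinal_number, has_construction_order G o' -> ordinal_leq o o'.

(* Main.v *)
(* Cut the ordinal [lambda] into blocks [w * xi + n] (w = omega) and let [lambda] itself
   be the vertex set. Inside a block, join codes at distance 1, 2 or 4. Across blocks,
   join a vertex whose code is a multiple of 4 to every later vertex with an even code.
   Finally join the least vertex [0] to all even codes. The order of [lambda] is then a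
   construction order: code [n + 2] is dominated by code [n], code 1 by code 0, and the
   start of a block by [0].
   Conversely, in any construction order [j] cannot be added after [j - 4], [j - 2],
   [j - 1] and [j + 1] of its block, and once a vertex [b] with an even code in a later
   block is present, a multiple of 4 cannot be added after its predecessor. If all large
   even codes of a block came after [b], these two constraints would give an infinite
   descent of positions. Hence [b] comes after infinitely many vertices with even codes
   of each earlier block, which by induction on [b] puts its position at or after the
   start of its own block; a construction order shorter than [lambda] would then
   inject too many vertices into a finite piece of a block. *)
From Stdlib Require Import Relation_Operators.
Require Import Defs.
From mathcomp Require Import all_boot zify.
From mathcomp Require Import boolp classical_sets cardinality wochoice.

Set Implicit Arguments.
Unset Strict Implicit.
Unset Printing Implicit Defensive.

Local Open Scope classical_set_scope.

Local Notation "a <=o b" := (ole a b) (at level 70, no associativity).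
Local Notation "a <o b" := (olt a b) (at level 70, no associativity).

(** * Well-orders *)

Lemma omin (o : ordinal_number) (P : o -> Prop) :
  (exists a, P a) -> exists a, P a /\ forall b, P b -> a <=o b.
Proof.
case=> a Pa; case: (@ole_well_order o [pred x | `[< P x >]]).
  by exists a; rewrite inE.
move=> z [[zP zmin] _]; exists z; split; first by move: zP; rewrite inE.
by move=> b Pb; apply: zmin; rewrite inE.
Qed.

(** The order axioms are read off from least elements of sets with at most three elements;
    uniqueness of the least element enters through antisymmetry. *)
Lemma ole_refl (o : ordinal_number) (a : o) : a <=o a.
Proof. by have [b [-> /(_ a erefl)]] := @omin o (fun x => x = a) (ex_intro _ a erefl). Qed.

Lemma ole_total (o : ordinal_number) (a b : o) : a <=o b \/ b <=o a.
Proof.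
have [|c [[->|->] cmin]] := @omin o (fun x => x = a \/ x = b); first by exists a; left.
- by left; apply: cmin; right.
- by right; apply: cmin; left.
Qed.

Lemma ole_anti (o : ordinal_number) (a b : o) : a <=o b -> b <=o a -> a = b.
Proof.
move=> ab ba; have [|z [_ zuniq]] := @ole_well_order o [pred x | `[< x = a \/ x = b >]].
  by exists a; rewrite inE; left.
have zP c : c = a \/ c = b -> z = c.
  move=> cab; apply: zuniq; split=> [|x]; rewrite inE //.
  by case: cab => -> [->|->] //; apply: ole_refl.
by rewrite -(zP a (or_introl erefl)); apply: zP; right.
Qed.

Lemma ole_trans (o : ordinal_number) (b a c : o) : a <=o b -> b <=o c -> a <=o c.
Proof.
move=> ab bc.
have [|d [dabc dmin]] := @omin o (fun x => [\/ x = a, x = b | x = c]).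
  by exists a; constructor 1.
have [da db] : d <=o a /\ d <=o b by split; apply: dmin; [constructor 1|constructor 2].
have dc : d <=o c by apply: dmin; constructor 3.
case: dabc => dE; subst d => //.
- by rewrite (ole_anti ab da).
- by rewrite -(ole_anti bc db).
Qed.

Lemma oltNge (o : ordinal_number) (a b : o) : (a <o b) = ~~ (b <=o a).
Proof. by rewrite /olt; case: (ole_total a b) => ->; rewrite /= ?andbT ?andbF. Qed.

Lemma oleNgt (o : ordinal_number) (a b : o) : (a <=o b) = ~~ (b <o a).
Proof. by rewrite oltNge negbK. Qed.

Lemma olt_irr (o : ordinal_number) (a : o) : (a <o a) = false.
Proof. by rewrite oltNge ole_refl. Qed.

Lemma oltW (o : ordinal_number) (a b : o) : a <o b -> a <=o b.
Proof. by case/andP. Qed.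

Lemma ole_lt_trans (o : ordinal_number) (b a c : o) : a <=o b -> b <o c -> a <o c.
Proof. by move=> ab; rewrite !oltNge; apply: contra => ca; apply: ole_trans ca ab. Qed.

Lemma olt_le_trans (o : ordinal_number) (b a c : o) : a <o b -> b <=o c -> a <o c.
Proof. by move=> + bc; rewrite !oltNge; apply: contra => ca; apply: ole_trans bc ca. Qed.

Lemma olt_trans (o : ordinal_number) (b a c : o) : a <o b -> b <o c -> a <o c.
Proof. by move=> ab /oltW; apply: olt_le_trans. Qed.

Lemma ole_eqVlt (o : ordinal_number) (a b : o) : a <=o b -> a = b \/ a <o b.
Proof.
rewrite oltNge => ab; case: (boolP (b <=o a)) => [ba|_]; last by right.
by left; apply: ole_anti.
Qed.

Lemma olt_neq (o : ordinal_number) (a b : o) : a <o b -> a <> b.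
Proof. by move=> + ab; rewrite ab olt_irr. Qed.

Lemma olt_total (o : ordinal_number) (a b : o) : [\/ a = b, a <o b | b <o a].
Proof.
case: (ole_total a b) => /ole_eqVlt[->|]; by [constructor 1|constructor 2|constructor 3].
Qed.

Lemma olt_ind (o : ordinal_number) (P : o -> Prop) :
  (forall a, (forall b, b <o a -> P b) -> P a) -> forall a, P a.
Proof.
move=> IH a; apply: contrapT => nPa.
have [|b [nPb bmin]] := @omin o (fun x => ~ P x); first by exists a.
apply/nPb/IH => c cb; apply: contrapT => /bmin.
by rewrite oleNgt cb.
Qed.

(* Holds exactly when [x] and [y] have the same height. *)
Inductive matched (o1 o2 : ordinal_number) (x : o1) (y : o2) : Prop :=
  Matched of
    (forall x', x' <o x -> exists2 y', y' <o y & matched x' y') &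
    (forall y', y' <o y -> exists2 x', x' <o x & matched x' y').

Lemma matched_fun (o1 o2 : ordinal_number) (x : o1) (y z : o2) :
  matched x y -> matched x z -> y = z.
Proof.
elim/olt_ind: x y z => x IH y z [fy gy] [fz gz].
case: (olt_total y z) => // [/gz|/gy] [x' x'x Mx'].
- by have [y' y'y /(IH _ x'x _ _ Mx') E] := fy _ x'x; move: y'y; rewrite -E olt_irr.
- by have [y' y'y /(IH _ x'x _ _ Mx') E] := fz _ x'x; move: y'y; rewrite -E olt_irr.
Qed.

Lemma matched_inj (o1 o2 : ordinal_number) (x y : o1) (z : o2) :
  matched x z -> matched y z -> x = y.
Proof.
elim/olt_ind: z x y => z IH x y [fx gx] [fy gy].
case: (olt_total x y) => // [/fy|/fx] [z' z'z Mz'].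
- by have [x' x'x Mx'] := gx _ z'z; move: x'x; rewrite (IH _ z'z _ _ Mx' Mz') olt_irr.
- by have [x' x'x Mx'] := gy _ z'z; move: x'x; rewrite (IH _ z'z _ _ Mx' Mz') olt_irr.
Qed.

Lemma matched_lt (o1 o2 : ordinal_number) (x y : o1) (z t : o2) :
  matched x z -> matched y t -> x <o y -> z <o t.
Proof. by move=> Mxz [f _] /f[z' z't /(matched_fun Mxz)->]. Qed.

(** If every element of [o1] has a partner of the same height, the matching embeds [o1] as an
    initial segment. Otherwise the least element [a] without a partner lies above the partners of
    all elements of [o2]. *)
Lemma ordinal_comparison (o1 o2 : ordinal_number) :
  ordinal_leq o1 o2 \/
  exists (a : o1) (f : o2 -> o1),
    (forall x, f x <o a) /\ (forall x y, x <o y -> f x <o f y).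
Proof.
have [allM|/existsNP[a0 nM0]] := pselect (forall a : o1, exists x : o2, matched x a).
  left; have [f fM] := choice allM.
  have fmono x y : x <o y -> f x <o f y.
    by move=> xy; case: (fM y) => _ /(_ _ xy) [z zy /(matched_inj (fM x))->].
  exists f; split=> [x y|x y].
    apply/idP/idP; first by rewrite !oleNgt; apply: contra => /fmono.
    by case/ole_eqVlt=> [->|/fmono/oltW //]; apply: ole_refl.
  case/ole_eqVlt=> [->|]; first by exists x.
  case: (fM x) => g _ /g[z zx Mz]; exists z.
  exact: matched_inj (fM z) Mz.
right; have [|a [nM amin]] := @omin o1 (fun a => ~ exists x : o2, matched x a).
  by exists a0.
have exM b : b <o a -> exists x : o2, matched x b.
  by move=> ba; apply: contrapT => /amin; rewrite oleNgt ba.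
have exf (x : o2) : exists b, b <o a /\ matched x b.
  elim/olt_ind: x => x IH.
  (* The partner of [x] is the least element not yet matched below [x]; [a] shows that there is
     one. *)
  have [|c [cP cmin]] := @omin o1 (fun b => ~ exists2 y, y <o x & matched y b).
    by exists a => -[y yx My]; apply: nM; exists y.
  have Mxc : matched x c.
    split=> [y yx|b bc]; last first.
      by apply: contrapT => /cmin; rewrite oleNgt bc.
    have [b [ba Mb]] := IH _ yx; exists b => //.
    case: (olt_total b c) => // [bc|cb]; case: cP; first by exists y; rewrite -?bc.
    case: Mb => _ /(_ _ cb)[z zy Mz]; exists z => //; exact: olt_trans zy yx.
  exists c; split => //; rewrite oltNge; apply/negP => /ole_eqVlt[ac|ac].
    by apply: nM; exists x; rewrite ac.
  by case: Mxc => _ /(_ _ ac) [z _ Mz]; apply: nM; exists z.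
have [f fP] := choice exf; exists a, f; split=> [x|x y]; first by case: (fP x).
by apply: matched_lt; [case: (fP x)|case: (fP y)].
Qed.

(** * Infinite and finite blocks *)

Definition immediate_pred (o : ordinal_number) (p a : o) : Prop :=
  p <o a /\ forall q, q <o a -> q <=o p.

Lemma immediate_pred_fun (o : ordinal_number) (p q a : o) :
  immediate_pred p a -> immediate_pred q a -> p = q.
Proof. by case=> pa pmax [qa qmax]; apply: ole_anti; [apply: qmax | apply: pmax]. Qed.

Lemma immediate_pred_inj (o : ordinal_number) (p a b : o) :
  immediate_pred p a -> immediate_pred p b -> a = b.
Proof.
case=> pa amax [pb bmax]; case: (olt_total a b) => // [/bmax|/amax].
  by rewrite oleNgt pa.
by rewrite oleNgt pb.
Qed.

(* [place a s n] says that [a = s + n] with [s] zero or a limit. *)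
Inductive place (o : ordinal_number) : o -> o -> nat -> Prop :=
| place0 a : (forall p, ~ immediate_pred p a) -> place a a 0
| placeS p a s n : immediate_pred p a -> place p s n -> place a s n.+1.

Lemma place_ex (o : ordinal_number) (a : o) : exists sn : o * nat, place a sn.1 sn.2.
Proof.
elim/olt_ind: a => a IH; have [[p pa]|/forallNP np] := pselect (exists p, immediate_pred p a).
  by have [[s n] psn] := IH p (proj1 pa); exists (s, n.+1); apply: placeS pa psn.
by exists (a, 0); apply: place0.
Qed.

Definition start (o : ordinal_number) (a : o) : o := (sval (cid (place_ex a))).1.

Definition offset (o : ordinal_number) (a : o) : nat := (sval (cid (place_ex a))).2.

Lemma place_start (o : ordinal_number) (a : o) : place a (start a) (offset a).
Proof. exact: svalP (cid (place_ex a)). Qed.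

Lemma place_fun (o : ordinal_number) (a s t : o) n m :
  place a s n -> place a t m -> s = t /\ n = m.
Proof.
move=> asn; elim: asn t m => {a s n} [a np|p a s n pa _ IH] t m atm.
  by case: atm np => // q b {}t {}m qb _ /(_ q).
case: atm pa => [b nb /nb //|q b {}t {}m qb qtm pb].
by have [] := IH t m; rewrite ?(immediate_pred_fun pb qb) // => -> ->.
Qed.

Lemma place_startE (o : ordinal_number) (a s : o) n :
  place a s n -> start a = s /\ offset a = n.
Proof. exact: place_fun (place_start a). Qed.

Lemma place_base (o : ordinal_number) (a s : o) n : place a s n -> place s s 0.
Proof. by elim=> // b nb; apply: place0. Qed.

Lemma start_id (o : ordinal_number) (a : o) : start (start a) = start a.
Proof. by have [] := place_startE (place_base (place_start a)). Qed.

Lemma offset_start (o : ordinal_number) (a : o) : offset (start a) = 0.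
Proof. by have [] := place_startE (place_base (place_start a)). Qed.

Lemma place_inj (o : ordinal_number) (a b s : o) n : place a s n -> place b s n -> a = b.
Proof.
move=> asn; elim: asn b => {a s n} [a _|p a s n pa _ IH] b bsn; first by inversion bsn.
inversion bsn as [|q b' s' n' qb qsn]; subst.
by apply: (immediate_pred_inj pa); rewrite (IH q).
Qed.

Lemma place_lt (o : ordinal_number) (a b s : o) n m :
  place a s n -> place b s m -> n < m -> a <o b.
Proof.
move=> asn bsm; elim: bsm asn => {b s m} // p b s m [pb _] psm IH asn.
rewrite ltnS leq_eqVlt => /orP[/eqP nm|nm]; last exact: olt_trans (IH asn nm) pb.
by subst m; rewrite (place_inj asn psm).
Qed.

Lemma place_sub (o : ordinal_number) (a s : o) n k :
  place a s n -> k <= n -> exists d, place d s k.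
Proof.
elim=> {a s n} [a na|p a s n pa psn IH].
  by case: k => // _; exists a; apply: place0.
rewrite leq_eqVlt => /orP[/eqP->|/IH //]; by exists a; apply: placeS pa psn.
Qed.

Lemma start_le (o : ordinal_number) (a : o) : start a <=o a.
Proof.
elim: (place_start a) => [b _|p b s n [pb _] _ sp]; first exact: ole_refl.
exact: ole_trans sp (oltW pb).
Qed.

Lemma start_mono (o : ordinal_number) (a b : o) : a <=o b -> start a <=o start b.
Proof.
elim: (place_start b) => {b} [b _|p b s n [pb bmax] psn IH ab].
  exact: ole_trans (start_le a).
case/ole_eqVlt: (ab) => [->|/bmax /IH //].
have [-> _] := place_startE (placeS (conj pb bmax) psn); exact: ole_refl.
Qed.

Lemma start_lt (o : ordinal_number) (a b : o) : start a <o start b -> a <o b.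
Proof. by rewrite !oltNge; apply: contra => /start_mono. Qed.

Lemma offset_lt (o : ordinal_number) (a b : o) :
  start a = start b -> (a <o b) = (offset a < offset b).
Proof.
move=> sab; have pa := place_start a; have pb := place_start b; rewrite sab in pa.
case: (ltngtP (offset a) (offset b)) => [ab|ba|E].
- exact: place_lt pa pb ab.
- by apply/negbTE; rewrite -oleNgt; apply/oltW/(place_lt pb pa).
- by rewrite -E in pb; rewrite (place_inj pa pb) olt_irr.
Qed.

Definition infinite_block (o : ordinal_number) (s : o) : Prop :=
  forall k, exists d, place d s k.

(** Every [d] in the block of [a] lies below [b], so there is a least element above [d]: its
    successor, in the same block. *)
Lemma infinite_block_lt (o : ordinal_number) (a b : o) :
  start a <o start b -> infinite_block (start a).
Proof.
move=> ab; elim=> [|k [d dk]]; first by exists (start a); apply: place_base (place_start a).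
have [sd _] := place_startE dk.
have [|c [dc cmin]] := @omin o (fun c => d <o c).
  by exists b; apply: start_lt; rewrite sd.
exists c; apply: placeS dk; split=> // q qc; rewrite oleNgt.
by apply: contraL qc => /cmin; rewrite oleNgt.
Qed.

(* Doubling in the finite last block, if there is one, makes all its codes even:
   only vertices with an even code will be forced to come late. *)
Definition code (o : ordinal_number) (a : o) : nat :=
  if `[< infinite_block (start a) >] then offset a else (offset a).*2.

Lemma code_lt (o : ordinal_number) (a b : o) :
  start a = start b -> (a <o b) = (code a < code b).
Proof.
by move=> sab; rewrite offset_lt // /code sab; case: ifP => // _; rewrite ltn_double.
Qed.

Lemma code_inj (o : ordinal_number) (a b : o) :
  start a = start b -> code a = code b -> a = b.
Proof.
move=> sab cab.
by case: (olt_total a b) => //; rewrite code_lt // cab ltnn.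
Qed.

Lemma code_start (o : ordinal_number) (a : o) : code (start a) = 0.
Proof. by rewrite /code offset_start; case: ifP. Qed.

Lemma code_infinite (o : ordinal_number) (a b : o) k :
  start a <o start b -> exists d, start d = start a /\ code d = k.
Proof.
move=> ab; have inf := infinite_block_lt ab; have [d dk] := inf k.
have [sd od] := place_startE dk; exists d; split=> //.
by rewrite /code sd od; case: asboolP.
Qed.

Lemma code_pred (o : ordinal_number) (a : o) n :
  code a = n.+2 -> exists d, start d = start a /\ code d = n.
Proof.
rewrite /code; case: asboolP => [inf _|fin an].
  have [d dn] := inf n; have [sd od] := place_startE dn; exists d.
  by rewrite sd od; case: asboolP.
have [d dk] := @place_sub _ a _ _ n./2 (place_start a) ltac:(lia).
have [sd od] := place_startE dk; exists d.
by rewrite sd od; case: asboolP => // _; split=> //; lia.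
Qed.

(** Supplies [offset a + 1] vertices with even codes in the block of [a], whether that block is
    infinite or finite, for the final count. *)
Lemma code_double (o : ordinal_number) (a : o) i :
  i <= offset a -> exists d, start d = start a /\ code d = i.*2.
Proof.
move=> ia; have [inf|fin] := pselect (infinite_block (start a)).
  have [d dk] := inf i.*2; have [sd od] := place_startE dk; exists d.
  by rewrite /code sd od; case: asboolP.
have [d dk] := place_sub (place_start a) ia; have [sd od] := place_startE dk; exists d.
by rewrite /code sd od; case: asboolP.
Qed.

(** * The graph *)

Definition near_codes (n m : nat) : Prop := [\/ m = n + 1, m = n + 2 | m = n + 4].

Definition uplink (o : ordinal_number) (x y : o) : Prop :=
  x <o y /\
  ((start x = start y /\ near_codes (code x) (code y)) \/
   (~~ odd (code y) /\
    ((forall z, x <=o z) \/ (start x <o start y /\ 4 %| code x)))).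

Definition link (o : ordinal_number) (x y : o) : Prop := uplink x y \/ uplink y x.

Lemma link_sym (o : ordinal_number) (x y : o) : link x y -> link y x.
Proof. by case; [right | left]. Qed.

Lemma link_irrefl (o : ordinal_number) (x : o) : ~ link x x.
Proof. by case=> -[]; rewrite olt_irr. Qed.

Lemma link_lt (o : ordinal_number) (x y : o) : x <o y -> link x y -> uplink x y.
Proof. by move=> /oltW + [//|[]]; rewrite oleNgt => /negbTE->. Qed.

Lemma uplink_near (o : ordinal_number) (x y : o) :
  start x = start y -> near_codes (code x) (code y) -> uplink x y.
Proof. by move=> sxy cxy; split; [rewrite code_lt //; case: cxy; lia | left]. Qed.

Lemma uplink_cross (o : ordinal_number) (x y : o) :
  start x <o start y -> 4 %| code x -> ~~ odd (code y) -> uplink x y.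
Proof. by move=> sxy cx cy; split; [apply: start_lt | right; split=> //; right]. Qed.

Lemma least_link (o : ordinal_number) (b x : o) :
  (forall z, b <=o z) -> ~~ odd (code x) -> x = b \/ link b x.
Proof.
move=> bmin cx; case: (ole_eqVlt (bmin x)) => [->|bx]; first by left.
by right; left; split=> //; right; split=> //; left.
Qed.

Lemma code_least (o : ordinal_number) (b : o) : (forall z, b <=o z) -> code b = 0.
Proof. by move=> bmin; rewrite (ole_anti (bmin (start b)) (start_le b)) code_start. Qed.

Lemma least_ex (o : ordinal_number) (a : o) : exists b : o, forall z, b <=o z.
Proof.
by have [|b [_ bmin]] := @omin o (fun _ => True); [exists a | exists b => z; apply: bmin].
Qed.

(** Earlier neighbours of a code 0 have even codes, hence are the least vertex or adjacent to it. An
    odd code has no neighbours outside its block, so code 1 sees only code 0 before it. For code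
    [n + 2], the earlier neighbours in the block have codes [n + 1], [n] and [n - 2], all within
    distance 2 of [n]; those outside are shared because [n] has the same parity. *)
Lemma link_dominated (o : ordinal_number) (a : o) : (exists c, c <o a) ->
  exists2 c, c <o a &
    forall d, d <=o a -> d = a \/ link a d -> d = c \/ link c d.
Proof.
case=> a0 a0a; have [b bmin] := least_ex a.
have ba : b <o a by apply: ole_lt_trans (bmin a0) a0a.
case ca: (code a) => [|[|n]].
- exists b => // d da adj_d; apply: least_link => //.
  case: adj_d => [->|/link_sym]; first by rewrite ca.
  case/ole_eqVlt: da => [->|da]; first by rewrite ca.
  case/(link_lt da) => _ [[sda]|[_ [dmin|[_ cd]]]].
  + by rewrite ca => -[]; lia.
  + by rewrite code_least.
  + lia.
- exists (start a); first by rewrite code_lt ?start_id // code_start ca.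
  move=> d da [->|/link_sym].
    by right; left; apply: uplink_near; rewrite ?start_id // code_start ca; constructor 1.
  case/ole_eqVlt: da => [->|da /(link_lt da)].
    by move=> _; right; left; apply: uplink_near; rewrite ?start_id // code_start ca; constructor 1.
  case=> _ [[sda]|[]]; last by rewrite ca.
  rewrite ca => -[] cd; try lia.
  by left; apply: code_inj; rewrite ?start_id // code_start; lia.
have [c [sc cc]] := code_pred ca.
have c_a : uplink c a by apply: uplink_near => //; rewrite ca cc; constructor 2; lia.
exists c; first by case: c_a.
move=> d da [->|/link_sym]; first by right; left.
case/ole_eqVlt: da => [->|da /(link_lt da)]; first by right; left.
case=> _ [[sda near]|[ea [dmin|[sda cd]]]].
- case: near; rewrite ca => cd.
  + by right; left; apply: uplink_near; rewrite ?sc // cc; constructor 1; lia.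
  + by left; apply: code_inj; rewrite ?sc // cc; lia.
  + by right; right; apply: uplink_near; rewrite ?sc // cc; constructor 2; lia.
- have ec : ~~ odd (code c) by lia.
  by case: (least_link dmin ec) => [->|/link_sym]; [left|right].
- by right; right; apply: uplink_cross; rewrite ?sc //; lia.
Qed.

(** A vertex is adjacent to its dominator, which is earlier; following dominators ends at the least
    vertex. *)
Lemma link_to_least (o : ordinal_number) (b a : o) :
  (forall z, b <=o z) -> clos_refl_trans o (@link o) a b.
Proof.
move=> bmin; elim/olt_ind: a => a IH.
case: (ole_eqVlt (bmin a)) => [->|ba]; first exact: rt_refl.
have [|c ca cdom] := @link_dominated o a; first by exists b.
apply: (rt_trans _ _ _ c); last exact: IH.
case: (cdom a (ole_refl a)) => [|ac|/link_sym ac]; first by left.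
  by move: ca; rewrite ac olt_irr.
exact: rt_step.
Qed.

Lemma link_connected (o : ordinal_number) (u v : o) : clos_refl_trans o (@link o) u v.
Proof.
have [b bmin] := least_ex u; apply: (rt_trans _ _ _ b); first exact: link_to_least.
elim: (link_to_least v bmin) => [x y /link_sym|x|x y z _ xy _ yz].
- exact: rt_step.
- exact: rt_refl.
- exact: rt_trans yz xy.
Qed.

Definition ordinal_graph (o : ordinal_number) : graph :=
  Graph (@link_sym o) (@link_irrefl o) (@link_connected o).

Lemma ordinal_graph_order (o : ordinal_number) :
  @construction_order (ordinal_graph o) o id.
Proof.
split=> [|a /link_dominated[c ca cdom]]; first by exists id.
have below d : ([set id x | x in [set e | e <=o a]] : set o) d -> d <=o a by case=> x /= xa <-.
exists c => //; split.
- by exists c => //=; apply: oltW.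
- by exists a => //=; apply: ole_refl.
- exact: olt_neq.
- by move=> d [Ad ad]; split=> //; apply: cdom ad; apply: below.
Qed.

(** * Every construction order is long *)

Lemma range_max (o : ordinal_number) (p : nat -> o) i n :
  exists2 j, i <= j <= i + n & forall k, i <= k <= i + n -> p k <=o p j.
Proof.
elim: n => [|n [j jin jmax]].
  by exists i => [|k ki]; [lia | rewrite (_ : k = i); [apply: ole_refl | lia]].
have kE k : i <= k <= i + n.+1 -> i <= k <= i + n \/ k = i + n.+1 by lia.
have [le|le] := ole_total (p j) (p (i + n.+1)).
  exists (i + n.+1) => [|k /kE[/jmax kj|->]]; first by lia.
    exact: ole_trans kj le.
  exact: ole_refl.
exists j => [|k /kE[/jmax//|->//]]; by lia.
Qed.

(* By the two hypotheses the maximum of [p] on [i, 4 k] is attained on [i, i + 3];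
   so the maxima on such short intervals would descend forever. *)
Lemma no_confined_maxima (o : ordinal_number) (p : nat -> o) N :
  injective p ->
  (forall j, N + 4 <= j -> ~ forall i, j - 4 <= i <= j + 1 -> i != j -> p i <o p j) ->
  (forall j, N + 4 <= j -> 4 %| j -> ~ p (j - 1) <o p j) ->
  False.
Proof.
move=> pinj left_right left_only.
have plt i j : p i <=o p j -> i != j -> p i <o p j.
  by move=> /ole_eqVlt[/pinj->|//]; rewrite eqxx.
have dom i : N <= i ->
    exists2 j, i <= j <= i + 3 & forall k, i + 4 <= k -> p k <o p j.
  move=> Ni; have [j jin jmax] := range_max p i 3; exists j => // k ik.
  (* The interval ends at the multiple [4 * k]: a maximum [J] beyond [i + 3] either has its whole
     window inside the interval or is that end, where [left_only] applies. *)
  have [J Jin Jmax] := range_max p i (4 * k - i).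
  have Ji : J <= i + 3.
    rewrite leqNgt; apply/negP => iJ; have [J4k|] := ltnP J (4 * k).
      by case: (left_right J) => [|l lin lJ]; [lia | apply: plt => //; apply: Jmax; lia].
    move=> kJ; case: (left_only J); [lia | lia |].
    by apply: plt; [apply: Jmax; lia | lia].
  apply: (@ole_lt_trans _ (p k)); first exact: ole_refl.
  by apply: olt_le_trans (jmax J _); [apply: plt; [apply: Jmax; lia | lia] | lia].
have [|v [[j [-> Nj jdom]] jmin]] := @omin o (fun v => exists j,
    [/\ v = p j, N <= j & forall k, j + 4 <= k -> p k <o p j]).
  have [j jin jdom] := dom N (leqnn N).
  by exists (p j), j; split=> // [|k jk]; [|apply: jdom]; lia.
have [i iin idom] := dom (j + 4) ltac:(lia).
have /jmin : exists l, [/\ p i = p l, N <= l & forall k, l + 4 <= k -> p k <o p l].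
  by exists i; split=> // [|k ik]; [|apply: idom]; lia.
by rewrite oleNgt jdom //; lia.
Qed.

(** Each value below [k] is taken at most once on [P], so [N] only has to pass finitely many
    points. *)
Lemma eventually_ge (P : nat -> Prop) (f : nat -> nat) k :
  (forall m n, P m -> P n -> f m = f n -> m = n) ->
  exists N, forall n, N <= n -> P n -> k <= f n.
Proof.
move=> finj; elim: k => [|k [N fN]]; first by exists 0.
have [[m [Pm fm]]|nm] := pselect (exists m, P m /\ f m = k).
  exists (maxn N m.+1) => n mn Pn; have := fN n ltac:(lia) Pn.
  rewrite leq_eqVlt => /orP[/eqP kf|//].
  by have := finj _ _ Pm Pn; rewrite fm => /(_ kf); lia.
exists N => n Nn Pn; have := fN n Nn Pn.
by rewrite leq_eqVlt => /orP[/eqP kf|//]; case: nm; exists n.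
Qed.

Lemma pigeonhole (f : nat -> nat) n :
  (forall i, i <= n -> f i < n) ->
  (forall i j, i <= n -> j <= n -> f i = f j -> i = j) -> False.
Proof.
move=> fn finj; suff: size (map f (iota 0 n.+1)) <= size (iota 0 n).
  by rewrite size_map !size_iota ltnn.
apply: uniq_leq_size.
  rewrite map_inj_in_uniq ?iota_uniq // => i j; rewrite !mem_iota => i_n j_n.
  by apply: finj; lia.
by move=> _ /mapP[i + ->]; rewrite !mem_iota => i_n; have := fn i; lia.
Qed.

(** * Excluding dominators *)

(** Both ends of any other edge have even codes: the later one by definition, the earlier one
    because its code is 0 or a multiple of 4. Odd codes thus confine a dominator to their block. *)
Lemma odd_link (o : ordinal_number) (v w : o) : odd (code v) -> link v w ->
  start v = start w /\ (near_codes (code v) (code w) \/ near_codes (code w) (code v)).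
Proof.
move=> ov [] [_ [[svw near]|[ew far]]].
- by split=> //; left.
- by case: far => [/code_least|[]]; lia.
- by split=> //; right.
- by rewrite ov in ew.
Qed.

(** Inside a block, only edges at the least vertex, of code 0, can join codes that are not near. *)
Lemma block_link (o : ordinal_number) (v w : o) :
  start v = start w -> 0 < code v -> 0 < code w -> link v w ->
  near_codes (code v) (code w) \/ near_codes (code w) (code v).
Proof.
move=> svw v0 w0 [] [_ [[_ near]|[_ [/code_least|[]]]]]; try lia.
- by left.
- by rewrite svw olt_irr.
- by right.
- by rewrite svw olt_irr.
Qed.

(** One of [j] and [j - 1] is odd, which puts [w] in the block. Its code is then at distance 0, 1, 2
    or 4 from each of [j - 4], [j] and [j + 1], and only [j] itself is. *)
Lemma no_window_dominator (o : ordinal_number) (s : nat -> o) (t w : o) j :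
  (forall n, start (s n) = t /\ code (s n) = n) ->
  9 <= j -> w <> s j ->
  (forall i, [\/ i = j - 4, i = j - 2 | i = j - 1] \/ i = j \/ i = j + 1 ->
     s i = w \/ link w (s i)) ->
  False.
Proof.
move=> sP j9 wj wdom.
have oddP i : odd i -> s i = w \/ link w (s i) ->
    start w = t /\ (i = code w \/ near_codes i (code w) \/ near_codes (code w) i).
  move=> oi; case: (sP i) => si ci [<-|/link_sym li]; first by split=> //; left.
  have oci : odd (code (s i)) by rewrite ci.
  by have [<- near] := odd_link oci li; split=> //; right; rewrite -ci.
have [wt w0] : start w = t /\ 0 < code w.
  have [oj|ej] := boolP (odd j).
    have [|-> ww] := oddP j oj; first by apply: wdom; right; left.
    by split=> //; case: ww => [|[[]|[]]]; lia.
  have [||-> ww] := oddP (j - 1); first by lia.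
    by apply: wdom; left; constructor 3.
  by split=> //; case: ww => [|[[]|[]]]; lia.
have nearP i : 0 < i -> s i = w \/ link w (s i) ->
    i = code w \/ near_codes i (code w) \/ near_codes (code w) i.
  move=> i0; case: (sP i) => si ci [<-|/link_sym li]; first by left.
  by right; have := block_link _ _ _ li; rewrite si ci wt; apply.
apply: wj; apply: code_inj; have [sj cj] := sP j; rewrite ?sj ?cj //.
have d4 := nearP (j - 4) ltac:(lia) (wdom _ (or_introl (Or31 _ _ erefl))).
have d2 := nearP (j - 2) ltac:(lia) (wdom _ (or_introl (Or32 _ _ erefl))).
have d1 := nearP (j - 1) ltac:(lia) (wdom _ (or_introl (Or33 _ _ erefl))).
have u1 := nearP (j + 1) ltac:(lia) (wdom _ (or_intror (or_intror erefl))).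
have d0 := nearP j ltac:(lia) (wdom _ (or_intror (or_introl erefl))).
rewrite /near_codes in d4 d2 d1 d0 u1.
case: d0 => [|[[]|[]]]; case: d4 => [|[[]|[]]]; case: u1 => [|[[]|[]]]; lia.
Qed.

(** The odd code of [u] keeps [w] in the block with a code within 4 of [code u]; the edge to [b]
    makes [code w] a multiple of 4. The offsets 0, 1, 2, 4 allow only [code u + 1], that is [v]. *)
Lemma no_cross_dominator (o : ordinal_number) (v u b w : o) :
  start v = start u -> 9 <= code v -> 4 %| code v -> code u = code v - 1 ->
  start v <o start b -> ~~ odd (code b) ->
  w <> v -> u = w \/ link w u -> b = w \/ link w b ->
  False.
Proof.
move=> suv v9 v4 cu vb eb wv wu wb; apply: wv.
have [sw cw] : start u = start w /\
    (code u = code w \/ near_codes (code u) (code w) \/ near_codes (code w) (code u)).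
  case: wu => [->|/link_sym uw]; first by split=> //; left.
  have ou : odd (code u) by lia.
  by have [-> near] := odd_link ou uw; split=> //; right.
have wltb : w <o b by apply: start_lt; rewrite -sw -suv.
case: wb => [bw|/(link_lt wltb)]; first by move: wltb; rewrite bw olt_irr.
case=> _ [[swb _]|[_ [/code_least w0|[_ w4]]]].
- by move: vb; rewrite suv sw swb olt_irr.
- by move: cw; rewrite w0 => -[|[[]|[]]]; lia.
- by apply: code_inj; [rewrite suv sw | case: cw => [|[[]|[]]]; lia].
Qed.

(** * Positions in a construction order *)

Lemma added_dominated (o o' : ordinal_number) (y : o' -> ordinal_graph o)
    (pos : o -> o') (v c : o) :
  construction_order y -> cancel pos y -> pos c <o pos v ->
  exists2 w : o, w <> v &
    forall u, pos u <=o pos v -> u = v \/ link v u -> u = w \/ link w u.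
Proof.
move=> [_ ydom] posK cv; have [|d dv [_ _ dneq dsub]] := ydom (pos v).
  by exists (pos c).
rewrite posK in dneq dsub; exists (y d) => // u uv vu.
suff /dsub[_ //] : closed_nbhd_in (y @` [set e | e <=o pos v]) v u.
by split=> //; exists (pos u) => //; apply: posK.
Qed.

Lemma start_le_position (o o' : ordinal_number) (y : o' -> ordinal_graph o)
    (pos : o -> o') (f : o' -> o) :
  construction_order y -> cancel y pos -> cancel pos y ->
  (forall x z, x <o z -> f x <o f z) ->
  forall b : o, ~~ odd (code b) -> start b <=o f (pos b).
Proof.
move=> yord yK posK fmono.
have fle x z : f x <=o f z -> x <=o z.
  by rewrite !oleNgt; apply: contra => /fmono.
have finj x z : f x = f z -> x = z.
  by move=> fxz; apply: ole_anti; apply: fle; rewrite fxz ole_refl.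
elim/olt_ind => b IH eb; rewrite oleNgt; apply/negP.
set c := f (pos b) => cb.
have scb : start c <o start b by apply: ole_lt_trans (start_le c) cb.
(* The block of [c] lies below that of [b], so it is infinite and contains a vertex [s n] of every
   code [n]. *)
have [s sP] := choice (fun n => code_infinite n scb).
have sb n : start (s n) <o start b by case: (sP n) => ->.
have sinj n m : s n = s m -> n = m.
  by move=> snm; have [_ <-] := sP n; have [_ <-] := sP m; rewrite snm.
pose early n := ~~ odd n /\ f (pos (s n)) <o c.
have early_start n : early n -> start (f (pos (s n))) = start c.
  case=> en fc; have [sn cn] := sP n; apply: ole_anti; first exact/start_mono/oltW.
  rewrite -sn -(start_id (s n)); apply: start_mono; apply: IH; first exact: start_lt.
  by rewrite cn.
(* By induction, early vertices have positions between [start c] and [c], a finite piece of one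
   block; hence only finitely many are early. *)
have [|N NP] := @eventually_ge early (fun n => code (f (pos (s n)))) (code c).
  move=> n m en em /(code_inj (etrans (early_start n en) (esym (early_start m em)))).
  by move/finj/(can_inj posK)/sinj.
have late n : N <= n -> ~~ odd n -> pos b <=o pos (s n).
  move=> Nn en; apply: fle; rewrite oleNgt; apply/negP => fc.
  have := NP n Nn (conj en fc); rewrite leqNgt -code_lt ?fc //.
  exact: early_start.
(* [N] places large even codes after [b]; 9 is the bound in both lemmas excluding dominators. *)
apply: (@no_confined_maxima o' (fun n => pos (s n)) (maxn N 9)).
- by move=> n m /(can_inj posK)/sinj.
- move=> j Nj before.
  have [|w wj wdom] := @added_dominated o o' y pos (s j) (s (j - 1)) yord posK.
    by apply: before; lia.
  apply: (no_window_dominator sP _ wj); first by lia.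
  have sE i : near_codes i j \/ near_codes j i -> link (s j) (s i).
    have [si ci] := sP i; have [sj cj] := sP j.
    by case=> near; [right|left]; apply: uplink_near; rewrite ?si ?sj ?ci ?cj.
  move=> i iE; apply: wdom.
    have [->|ij] := eqVneq i j; first exact: ole_refl.
    by apply/oltW/before => //; case: iE => [[]|[]]; lia.
  case: iE => [[]|[]] iE; rewrite iE; [right|right|right|by left|right]; apply: sE.
  + by left; constructor 3; lia.
  + by left; constructor 2; lia.
  + by left; constructor 1; lia.
  + by right; constructor 1.
- move=> j Nj j4 before; have [si ci] := sP (j - 1); have [sj cj] := sP j.
  have [w wj wdom] := @added_dominated o o' y pos (s j) (s (j - 1)) yord posK before.
  apply: (@no_cross_dominator o (s j) (s (j - 1)) b w); rewrite ?ci ?cj ?si ?sj //.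
  + by lia.
  + apply: wdom; first exact: oltW.
    right; right; apply: uplink_near; rewrite ?si ?sj ?ci ?cj //.
    by constructor 1; lia.
  + apply: wdom; first by apply: late; lia.
    by right; left; apply: uplink_cross; rewrite ?sj ?cj.
Qed.

(** Otherwise [f] sends all positions below some [a]. The vertices of codes 0, 2, ...,
    [2 * offset a] in the block of [a] then need [offset a + 1] distinct positions from [start a] up
    to below [a], where there are only [offset a]. *)
Lemma ordinal_graph_least (o o' : ordinal_number) :
  has_construction_order (ordinal_graph o) o' -> ordinal_leq o o'.
Proof.
case=> y yord; have [//|[a [f [fa fmono]]]] := ordinal_comparison o o'; exfalso.
have [[pos yK posK] _] := yord.
have finj x z : f x = f z -> x = z.
  by move=> fxz; case: (olt_total x z) => // /fmono; rewrite fxz olt_irr.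
(* Capping [i] at [offset a] makes [e] total; only the indices up to [offset a] are compared. *)
have [e eP] := choice (fun i => code_double (geq_minr i (offset a))).
have start_a i : start (f (pos (e i))) = start a.
  have [si ci] := eP i; apply: ole_anti; first exact/start_mono/oltW/fa.
  rewrite -{1}si -(start_id (e i)); apply: start_mono.
  by apply: (start_le_position yord yK posK fmono); rewrite ci odd_double.
apply: (@pigeonhole (fun i => offset (f (pos (e i)))) (offset a)) => [i _|i j ia ja].
  by rewrite -offset_lt ?fa.
move=> oij; have /finj/(can_inj posK) eij : f (pos (e i)) = f (pos (e j)).
  apply: (place_inj (place_start _)); rewrite start_a oij -(start_a j).
  exact: place_start.
have [[_ ci] [_ cj]] := (eP i, eP j).
by move: ci; rewrite eij cj; lia.
Qed.

Theorem theorem14 (lambda : ordinal_number)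
    (lambda_countable : countable [set: lambda])
    (lambda_gt0 : [set: lambda] !=set0) :
  exists G : graph, constructible G /\ is_construction_time G lambda.
Proof.
have has_order : has_construction_order (ordinal_graph lambda) lambda.
  by exists id; apply: ordinal_graph_order.
exists (ordinal_graph lambda); split; first by exists lambda.
by split=> // o'; apply: ordinal_graph_least.
Qed.
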